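(* Let $A=\hat A=\{a_1,\dots,a_k\}\subset\mathbb{R}$ be finite, let $P$ be a probability mass function on $A$ with $P_i=P(a_i)>0$ for all $i$, and let $\rho:A\times A\to[0,\infty)$, $\rho_{ij}=\rho(a_i,a_j)$, be symmetric ($\rho_{ij}=\rho_{ji}$ for all $i,j$) with $\rho_{ij}=0$ if and only if $i=j$. Assume $D_{\max}=\min_j \sum_i P_i\rho_{ij}>0$. Let $X_1$ be a random variable with distribution $P$, and for each $D\in(0,D_{\max})$ let $f=f_D:A\to\mathbb{R}$ be the function defined in the context. (a) If $P$ is the uniform distribution on $A$ and $\rho$ is a permutation distortion measure, then $f_D(X_1)=0$ with probability one for all $D\in(0,D_{\max})$. (b) If there is a sequence of distortion values $D_n\in(0,D_{\max})$ with $D_n\downarrow 0$ such that, for every $n$, $f_{D_n}(X_1)=0$ with probability one, then $P$ is the uniform distribution on $A$ and $\rho$ is a permutation distortion measure (and therefore $f_D(X_1)=0$ with probability one for all $D\in(0,D_{\max})$).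
   Context: $\rho$ is called a permutation distortion measure if all rows of the matrix $(\rho_{ij})_{i,j=1,\dots,k}$ are permutations of one another (equivalently, by symmetry, all columns are). $\log$ is to base 2 and $\log_e$ is the natural logarithm. For a probability mass function $Q$ on $\hat A$ and $D\ge 0$ let $$R(P,Q,D)=\inf_{(X,Z)}\big[I(X;Z)+H(Q_Z\|Q)\big],$$ where the infimum is over jointly distributed $(X,Z)$ with values in $A\times\hat A$ such that $X$ has distribution $P$ and $E[\rho(X,Z)]\le D$; $Q_Z$ is the distribution of $Z$, $I$ is mutual information in bits, and $H(R\|Q)=\sum_{a}R(a)\log[R(a)/Q(a)]$ is relative entropy in bits. The rate-distortion function is $R(D)=\inf_{(X,Y)} I(X;Y)$, the infimum being over jointly distributed $(X,Y)$ in $A\times\hat A$ with $X\sim P$ and $E[\rho(X,Y)]\le D$; thus $R(D)=\inf_Q R(P,Q,D)$, the infimum being over all probability mass functions $Q$ on $\hat A$. For $\lambda\le 0$ let $\Lambda_{P,Q}(\lambda)=E_P\big[\log_e E_Q\big(e^{\lambda\rho(X,Y)}\big)\big]$, where $X\sim P$ and $Y\sim Q$ are independent and the inner expectation is over $Y$ only; let $\Lambda^*_{P,Q}(D)=\sup_{\lambda\le 0}[\lambda D-\Lambda_{P,Q}(\lambda)]$. Known facts used to define $f$: for every $D\in(0,D_{\max})$ there is a $Q^*$ with $R(P,Q^*,D)=R(D)$, and for such a $Q^*$ there is a unique $\lambda^*<0$ with $\Lambda'_{P,Q^*}(\lambda^* )=D$; it satisfies $\lambda^*D-\Lambda_{P,Q^*}(\lambda^*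 )=\Lambda^*_{P,Q^*}(D)=(\log_e 2)R(P,Q^*,D)=(\log_e 2)R(D)$. For each $D\in(0,D_{\max})$ choose such $Q^*$ and $\lambda^*$ (depending on $D$) and define, for $x\in A$, $$f(x)=f_D(x)=(\log e)\Big[\lambda^*D-\log_e E_{Q^*}\big(e^{\lambda^*\rho(x,Y)}\big)\Big]-R(D),\qquad Y\sim Q^*.$$ *)

(* Defs.v *)
From HB Require Import structures.
From mathcomp Require Export all_boot all_order all_algebra perm finmap.
From mathcomp Require Export all_classical all_reals all_analysis.
Export Order.TTheory GRing.Theory Num.Theory.
Export numFieldNormedType.Exports.

Set Implicit Arguments.
Unset Strict Implicit.
Unset Printing Implicit Defensive.

Local Open Scope classical_set_scope.
Local Open Scope ring_scope.

Definition log2 (R : realType) (x : R) : R := ln x / ln 2.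

Definition is_pmf (R : realType) (T : finType) (P : T -> R) : Prop :=
  (forall a, 0 <= P a) /\ \sum_a P a = 1.

Definition is_uniform (R : realType) (T : finType) (P : T -> R) : Prop :=
  forall a, P a = #|T|%:R^-1.

Definition permutation_distortion (R : realType) (T : finType)
    (rho : T -> T -> R) : Prop :=
  forall i i' : T, exists s : {perm T}, forall j, rho i' j = rho i (s j).

(* The infimum of a finite family, nonempty as soon as T is: a minimum. *)
Definition D_max (R : realType) (T : finType) (P : T -> R)
    (rho : T -> T -> R) : R :=
  inf (range (fun j => \sum_i P i * rho i j)).

(* H(p || q) in bits, with 0 log (0 / q) = 0, and +oo when p is not absolutely
   continuous with respect to q. *)
Definition rel_entropy (R : realType) (T : finType) (p q : T -> R) : \bar R :=
  if [forall a, (q a == 0) ==> (p a == 0)]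
  then (\sum_a p a * log2 (p a / q a))%:E else +oo%E.

(* A pair (X, Z) is represented by its joint probability mass function W. *)
Definition marginal1 (R : realType) (T : finType) (W : T * T -> R) (x : T) : R :=
  \sum_z W (x, z).

Definition marginal2 (R : realType) (T : finType) (W : T * T -> R) (z : T) : R :=
  \sum_x W (x, z).

Definition mutual_info (R : realType) (T : finType) (W : T * T -> R) : \bar R :=
  rel_entropy W (fun xz => marginal1 W xz.1 * marginal2 W xz.2).

Definition admissible (R : realType) (T : finType) (P : T -> R)
    (rho : T -> T -> R) (D : R) : set (T * T -> R) :=
  [set W | [/\ is_pmf W, (forall x, marginal1 W x = P x) &
               \sum_xz W xz * rho xz.1 xz.2 <= D]].

Definition rate_fixed (R : realType) (T : finType) (P : T -> R)
    (rho : T -> T -> R) (Q : T -> R) (D : R) : \bar R :=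
  ereal_inf [set (mutual_info W + rel_entropy (marginal2 W) Q)%E
            | W in admissible P rho D].

Definition rate_distortion (R : realType) (T : finType) (P : T -> R)
    (rho : T -> T -> R) (D : R) : \bar R :=
  ereal_inf [set mutual_info W | W in admissible P rho D].

Definition inner_mgf (R : realType) (T : finType) (rho : T -> T -> R)
    (Q : T -> R) (lambda : R) (x : T) : R :=
  \sum_y Q y * expR (lambda * rho x y).

Definition Lambda (R : realType) (T : finType) (P : T -> R)
    (rho : T -> T -> R) (Q : T -> R) (lambda : R) : R :=
  \sum_x P x * ln (inner_mgf rho Q lambda x).

(* (Q, lambda) is an eligible choice of Q^* and lambda^* at distortion D. *)
Definition optimal_choice (R : realType) (T : finType) (P : T -> R)
    (rho : T -> T -> R) (D : R) (Q : T -> R) (lambda : R) : Prop :=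
  [/\ is_pmf Q, rate_fixed P rho Q D = rate_distortion P rho D,
      lambda < 0 & is_derive lambda 1 (Lambda P rho Q) D].

(* [fine] is harmless: the rate-distortion function is finite for D > 0. *)
Definition f_dist (R : realType) (T : finType) (P : T -> R)
    (rho : T -> T -> R) (D : R) (Q : T -> R) (lambda : R) (x : T) : R :=
  log2 (expR 1) * (lambda * D - ln (inner_mgf rho Q lambda x))
    - fine (rate_distortion P rho D).

Definition has_law (R : realType) (T : finType) (d : measure_display)
    (Omega : measurableType d) (Pr : probability Omega R)
    (X : Omega -> T) (P : T -> R) : Prop :=
  forall a, measurable (X @^-1` [set a]) /\ Pr (X @^-1` [set a]) = (P a)%:E.

(* Main.v *)
(** Let V be the joint law of (X, Z) obtained from P x Q by tilting the conditional
    law of Z given X = x by exp (lambda rho(x, .)).  Gibbs' inequality against V gives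
    (log_e 2) R(P,Q,D) = lambda D - Lambda(lambda) whenever V has distortion D, so f
    vanishes exactly when M(x) = E_Q exp (lambda rho(x, Y)) does not depend on x, and
    optimality of Q forces the second marginal of V to be Q.

    (a) The uniform law, with its own parameter, is at least as good as Q* by Jensen's
    inequality; since Q* is optimal, equality holds in Jensen, so M is constant.

    (b) For small D, V concentrates near the diagonal and Q* has full support; if M is
    constant, the marginal identity reads
    sum_x P(x) exp (lambda rho(x, y)) = c for all y.  As D -> 0 the off-diagonal
    exponentials vanish, hence P is uniform; then the exponential sums of all columns
    of rho agree along lambda -> -oo, so these columns are permutations of one
    another. *)

Require Import Defs.
From HB Require Import structures.
From mathcomp Require Import all_boot all_order all_algebra perm finmap.
From mathcomp Require Import all_classical all_reals all_analysis.
From mathcomp Require Import ring lra.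
Import numFieldNormedType.Exports.

Set Implicit Arguments.
Unset Strict Implicit.
Unset Printing Implicit Defensive.

Local Open Scope classical_set_scope.
Local Open Scope ring_scope.

(** * Relative entropy in nats: Gibbs' inequality and its equality case *)

Section RelativeEntropyInNats.
Context {R : realType}.
Implicit Types (x y : R).

Lemma ln_le_subr1 x : 0 < x -> ln x <= x - 1.
Proof.
move=> x0; have := @le_ln1Dx R (x - 1); rewrite (addrC 1) subrK; apply; lra.
Qed.

Lemma ln_eq_subr1 x : 0 < x -> ln x = x - 1 -> x = 1.
Proof.
move=> x0 lnx; apply: contra_eq (lnK x0) => x1; rewrite lnx.
have := @expR_gt1Dx R (x - 1); rewrite subr_eq0 => /(_ x1); lra.
Qed.

Lemma ln2_gt0 : 0 < ln 2 :> R.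
Proof. by apply: ln_gt0; lra. Qed.

(** Multiply [ln u <= u - 1] at [u = y / x] by [x]. The implication excludes [x > 0 = y], where
    [x / 0 = 0] and [ln 0 = 0] would make the right-hand side zero. *)
Lemma mul_ln_div_ge x y : 0 <= x -> 0 <= y -> (y = 0 -> x = 0) ->
  x - y <= x * ln (x / y).
Proof.
move=> x0 y0 yx; have [->|xN0] := eqVneq x 0; first by rewrite mul0r; lra.
have {}x0 : 0 < x by rewrite lt_def xN0.
have {}y0 : 0 < y.
  by rewrite lt_def y0 andbT; apply: contra_neq xN0.
have := ln_le_subr1 (divr_gt0 y0 x0).
rewrite -(invf_div x y) lnV ?posrE ?divr_gt0// => h.
have /(ler_wpM2l (ltW x0)) := h.
by rewrite mulrBr mulr1 invf_div mulrCA divff// mulr1; lra.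
Qed.

Lemma mul_ln_div_eq x y : 0 <= x -> 0 <= y -> (y = 0 -> x = 0) ->
  x * ln (x / y) = x - y -> x = y.
Proof.
move=> x0 y0 yx; have [->|xN0] := eqVneq x 0; first by rewrite mul0r; lra.
have {}x0 : 0 < x by rewrite lt_def xN0.
have {}y0 : 0 < y.
  by rewrite lt_def y0 andbT; apply: contra_neq xN0.
move=> h; have yx0 := divr_gt0 y0 x0.
suff /(congr1 ( *%R^~ x)) : y / x = 1 by rewrite mulfVK// mul1r.
apply: ln_eq_subr1 => //; apply: (mulfI xN0).
rewrite -(invf_div x y) lnV ?posrE ?divr_gt0// mulrN h invf_div.
by rewrite mulrBr mulrCA divff//; lra.
Qed.

Context {I : finType}.
Implicit Types p q : I -> R.

(** A real number even without absolute continuity, so it stands for the relative entropy only under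
    [dominated]. *)
Definition kl p q : R := \sum_a p a * ln (p a / q a).

Definition dominated p q := forall a, q a = 0 -> p a = 0.

Lemma kl_ge0 p q : is_pmf p -> is_pmf q -> dominated p q -> 0 <= kl p q.
Proof.
move=> [p0 p1] [q0 q1] pq.
rewrite -(subrr 1) -{1}p1 -q1 -sumrB.
by apply: ler_sum => a _; apply: mul_ln_div_ge => //; exact: pq.
Qed.

(** The termwise gaps in Gibbs' inequality are nonnegative and sum to [kl p q], hence all vanish. *)
Lemma kl_le0_eq p q : is_pmf p -> is_pmf q -> dominated p q ->
  kl p q <= 0 -> p =1 q.
Proof.
move=> [p0 p1] [q0 q1] pq le0 a.
have ge0 b : 0 <= p b * ln (p b / q b) - (p b - q b).
  by rewrite subr_ge0; apply: mul_ln_div_ge => //; exact: pq.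
have : \sum_b (p b * ln (p b / q b) - (p b - q b)) = 0.
  apply/eqP; rewrite eq_le sumr_ge0 ?andbT//.
  by rewrite sumrB sumrB p1 q1 subrr subr0.
move/eqP; rewrite psumr_eq0// => /allP/(_ a (mem_index_enum _)) /eqP.
by move=> /eqP; rewrite subr_eq0 => /eqP; apply: mul_ln_div_eq => //; exact: pq.
Qed.

Lemma kl_self p : kl p p = 0.
Proof.
apply: big1 => a _; have [->|pN0] := eqVneq (p a) 0; first by rewrite mul0r.
by rewrite divff// ln1 mulr0.
Qed.

Lemma rel_entropyE p q : dominated p q -> rel_entropy p q = (kl p q / ln 2)%:E.
Proof.
move=> pq; rewrite /rel_entropy ifT.
  by congr EFin; rewrite mulr_suml; apply: eq_bigr => a _; rewrite mulrA.
by apply/forallP => a; apply/implyP => /eqP/pq ->.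
Qed.

Lemma rel_entropy_dominated p q : rel_entropy p q != +oo%E -> dominated p q.
Proof.
rewrite /rel_entropy; case: ifPn; last by rewrite eqxx.
by move=> /forallP pq _ a qa; apply/eqP; have /implyP := pq a; apply; apply/eqP.
Qed.

Lemma rel_entropy_ge0 p q : is_pmf p -> is_pmf q -> (0 <= rel_entropy p q)%E.
Proof.
move=> hp hq; have [->|] := eqVneq (rel_entropy p q) +oo%E; first exact: leey.
move=> /rel_entropy_dominated pq; rewrite rel_entropyE// lee_fin.
by apply: divr_ge0; [exact: kl_ge0|exact/ltW/ln2_gt0].
Qed.

End RelativeEntropyInNats.

(** * Exponentially tilted couplings and the formula for R(P,Q,D) *)

Lemma is_derive_bigsum (R : realType) (I : Type) (r : seq I)
    (F : I -> R -> R) (dF : I -> R) (x : R) :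
  (forall i, is_derive x 1 (F i) (dF i)) ->
  is_derive x 1 (fun t => \sum_(i <- r) F i t) (\sum_(i <- r) dF i).
Proof.
move=> FdF; elim: r => [|i r IHr].
  rewrite big_nil (_ : (fun t => _) = cst 0).
    exact: is_derive_cst.
  by apply/funext => t; rewrite big_nil.
rewrite big_cons (_ : (fun t => _) = F i + (fun t => \sum_(j <- r) F j t)).
  exact: is_deriveD.
by apply/funext => t; rewrite big_cons.
Qed.

Lemma sum_pair {R : realType} {T : finType} (F : T * T -> R) :
  \sum_xz F xz = \sum_x \sum_z F (x, z).
Proof.
by rewrite (pair_bigA _ (fun x z => F (x, z)))/=; apply: eq_bigr => -[].
Qed.

Section TiltedCoupling.
Context {R : realType} {T : finType}.
Variables (P : T -> R) (rho : T -> T -> R).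
Hypotheses (hP : is_pmf P) (P_gt0 : forall x, 0 < P x).
Implicit Types (Q : T -> R) (W : T * T -> R) (l D : R) (x y z : T).

Let M := inner_mgf rho.

(* The joint law of [(X, Z)] with [X ~ P] whose conditional law given [X = x] is
   [Q] exponentially tilted by [l * rho x]. *)
Definition tilt Q l (xz : T * T) : R :=
  P xz.1 * (Q xz.2 * expR (l * rho xz.1 xz.2) / inner_mgf rho Q l xz.1).

Definition prod_pmf Q (xz : T * T) : R := P xz.1 * Q xz.2.

Definition distortion W : R := \sum_xz W xz * rho xz.1 xz.2.

Lemma inner_mgf_gt0 Q l x : is_pmf Q -> 0 < M Q l x.
Proof.
move=> [Q0 Q1]; rewrite lt_def sumr_ge0 ?andbT; last first.
  by move=> y _; rewrite mulr_ge0// expR_ge0.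
apply/negP; rewrite psumr_eq0; last by move=> y _; rewrite mulr_ge0// expR_ge0.
move=> /allP Qe; have : \sum_a Q a = 0.
  apply: big1 => y _; have := Qe y (mem_index_enum _).
  by rewrite mulf_eq0 (gt_eqF (expR_gt0 _)) orbF => /eqP.
by rewrite Q1 => /eqP; rewrite oner_eq0.
Qed.

Lemma tilt_ge0 Q l xz : is_pmf Q -> 0 <= tilt Q l xz.
Proof.
move=> hQ; apply: mulr_ge0; first exact/ltW.
rewrite divr_ge0 ?mulr_ge0 ?expR_ge0//; first by case: hQ.
exact/ltW/inner_mgf_gt0.
Qed.

Lemma marginal1_tilt Q l x : is_pmf Q -> marginal1 (tilt Q l) x = P x.
Proof.
move=> hQ; rewrite /marginal1 /tilt/= -mulr_sumr -mulr_suml divff ?mulr1//.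
exact/lt0r_neq0/inner_mgf_gt0.
Qed.

Lemma is_pmf_tilt Q l : is_pmf Q -> is_pmf (tilt Q l).
Proof.
move=> hQ; split=> [xz|]; first exact: tilt_ge0.
rewrite sum_pair; case: hP => _ <-; apply: eq_bigr => x _.
exact: marginal1_tilt.
Qed.

(** The logarithmic derivative of [inner_mgf] is the mean of [rho x] under the tilted conditional
    law. The derivative condition in [optimal_choice] thus fixes the distortion of the tilted
    coupling. *)
Lemma is_derive_Lambda Q l : is_pmf Q ->
  is_derive l 1 (Lambda P rho Q) (distortion (tilt Q l)).
Proof.
move=> hQ; rewrite /distortion sum_pair.
apply: is_derive_bigsum => x.
rewrite -[X in is_derive _ _ X _]/((cst (P x)) * (@ln R \o (fun t => M Q t x))).
have dM : is_derive l 1 (fun t => M Q t x)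
    (\sum_y Q y * (expR (l * rho x y) * rho x y)).
  apply: is_derive_bigsum => y.
  have dlin : is_derive l 1 (fun t => t * rho x y) (rho x y).
    rewrite -[X in is_derive _ _ X _]/(id * (cst (rho x y))).
    apply: is_derive_eq; rewrite scaler0 add0r.
    by rewrite -[LHS]/(rho x y * 1) mulr1.
  rewrite -[X in is_derive _ _ X _]/
    ((cst (Q y)) * (expR \o (fun t => t * rho x y))).
  have dexp := @is_derive1_comp _ _ (fun t => t * rho x y) l _ _
    (is_derive_expR (l * rho x y)) dlin.
  by apply: is_derive_eq; rewrite scaler0 addr0.
have dln := @is_derive1_comp _ _ (fun t => M Q t x) l _ _
  (is_derive1_ln (inner_mgf_gt0 l x hQ)) dM.
apply: is_derive_eq; rewrite scaler0 addr0 -[LHS]/(P x * _) mulrA mulr_sumr.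
by apply: eq_bigr => y _; rewrite /tilt/=; ring.
Qed.

Lemma pmf_marginal2 W : is_pmf W -> is_pmf (marginal2 W).
Proof.
move=> [W0 W1]; split=> [z|]; first by apply: sumr_ge0 => x _.
by rewrite exchange_big/= -sum_pair.
Qed.

Lemma marginal2_eq0 W x z : is_pmf W -> marginal2 W z = 0 -> W (x, z) = 0.
Proof.
move=> [W0 _] /eqP; rewrite psumr_eq0// => /allP/(_ x (mem_index_enum _))/eqP.
by [].
Qed.

Lemma mutual_info_dominated W : is_pmf W -> (forall x, marginal1 W x = P x) ->
  dominated W (fun xz => marginal1 W xz.1 * marginal2 W xz.2).
Proof.
move=> hW W1 [x z]/= /eqP; rewrite W1 mulf_eq0 (gt_eqF (P_gt0 x))/= => /eqP.
exact: marginal2_eq0.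
Qed.

Lemma prod_pmf_dominated W Q : is_pmf W -> dominated (marginal2 W) Q ->
  dominated W (prod_pmf Q).
Proof.
move=> hW WQ [x z] /= /eqP; rewrite /prod_pmf/= mulf_eq0 (gt_eqF (P_gt0 x))/=.
by move=> /eqP/WQ; exact: marginal2_eq0.
Qed.

Lemma tilt_dominated W Q l : is_pmf Q -> dominated W (prod_pmf Q) ->
  dominated W (tilt Q l).
Proof.
move=> hQ WPQ xz /eqP; rewrite /tilt !mulf_eq0 invr_eq0.
rewrite (gt_eqF (expR_gt0 _)) (gt_eqF (inner_mgf_gt0 _ _ hQ)) !orbF.
by rewrite -mulf_eq0 => /eqP/WPQ.
Qed.

Lemma marginal2_tilt_dominated Q l : dominated (marginal2 (tilt Q l)) Q.
Proof.
by move=> z Qz; apply: big1 => x _; rewrite /tilt/= Qz !mul0r mulr0.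
Qed.

(** Chain rule: it turns the objective of R(P,Q,D) into a single divergence from the product law. *)
Lemma kl_chain W Q : is_pmf W -> (forall x, marginal1 W x = P x) -> is_pmf Q ->
  dominated (marginal2 W) Q ->
  kl W (fun xz => marginal1 W xz.1 * marginal2 W xz.2) + kl (marginal2 W) Q =
  kl W (prod_pmf Q).
Proof.
move=> hW W1 hQ WQ; rewrite /kl [in X in _ + X]/marginal2.
under [X in _ + X]eq_bigr do rewrite mulr_suml.
rewrite exchange_big/= -(sum_pair (fun xz => W xz * ln (marginal2 W xz.2 / Q xz.2))).
rewrite -big_split/=; apply: eq_bigr => -[x z] _ /=.
have [->|WN0] := eqVneq (W (x, z)) 0; first by rewrite !mul0r addr0.
have W0 : 0 < W (x, z) by rewrite lt_def WN0 (proj1 hW).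
have m0 : 0 < marginal2 W z.
  rewrite lt_def; rewrite (proj1 (pmf_marginal2 hW)) andbT.
  by apply: contra_neq WN0 => /(marginal2_eq0 x hW).
have Q0 : 0 < Q z.
  rewrite lt_def; rewrite (proj1 hQ) andbT.
  by apply: contra_neq (lt0r_neq0 m0); exact: WQ.
rewrite -mulrDr; congr (_ * _).
rewrite W1 -lnM ?posrE ?divr_gt0 ?mulr_gt0//; congr ln.
rewrite /prod_pmf/=; field.
by rewrite !lt0r_neq0.
Qed.

(** The tilted law has density [expR (l * rho x z) / inner_mgf rho Q l x] with respect to the
    product; integrate its logarithm against [W]. *)
Lemma kl_tilt W Q l : is_pmf W -> (forall x, marginal1 W x = P x) -> is_pmf Q ->
  dominated W (prod_pmf Q) ->
  kl W (prod_pmf Q) = kl W (tilt Q l) + (l * distortion W - Lambda P rho Q l).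
Proof.
move=> hW W1 hQ WPQ; rewrite /Lambda.
under [X in _ - X]eq_bigr => x _ do rewrite -W1 mulr_suml.
rewrite -(sum_pair (fun xz => W xz * ln (M Q l xz.1))).
rewrite mulr_sumr -sumrB -big_split/=; apply: eq_bigr => -[x z] _ /=.
have [->|WN0] := eqVneq (W (x, z)) 0; first by rewrite !mul0r mulr0 subrr addr0.
have W0 : 0 < W (x, z) by rewrite lt_def WN0 (proj1 hW).
have Q0 : 0 < Q z.
  rewrite lt_def; rewrite (proj1 hQ) andbT.
  by apply: contra_neq WN0 => Qz; apply: WPQ; rewrite /prod_pmf Qz mulr0.
have M0 := inner_mgf_gt0 l x hQ.
have -> : W (x, z) / prod_pmf Q (x, z) =
    (W (x, z) / tilt Q l (x, z)) * expR (l * rho x z) / M Q l x.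
  rewrite /tilt /prod_pmf/= -/M; field.
  by rewrite !lt0r_neq0// expR_gt0.
have t0 : 0 < tilt Q l (x, z).
  by rewrite /tilt/= mulr_gt0// divr_gt0// mulr_gt0// expR_gt0.
rewrite ln_div ?posrE ?mulr_gt0 ?divr_gt0 ?expR_gt0 ?invr_gt0//.
by rewrite lnM ?posrE ?divr_gt0 ?expR_gt0// expRK; ring.
Qed.

Lemma info_divergenceE W Q : is_pmf W -> (forall x, marginal1 W x = P x) ->
  is_pmf Q -> dominated (marginal2 W) Q ->
  (mutual_info W + rel_entropy (marginal2 W) Q)%E = (kl W (prod_pmf Q) / ln 2)%:E.
Proof.
move=> hW W1 hQ WQ; rewrite /mutual_info !rel_entropyE//; last first.
  exact: mutual_info_dominated.
by rewrite -EFinD -mulrDl kl_chain.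
Qed.

(** The tilted coupling attains the value. For any other admissible [W], drop the nonnegative
    divergence in [kl_tilt]; since [l <= 0], the distortion bound gives
    [l * D <= l * distortion W]. *)
Lemma rate_fixedE Q l D : is_pmf Q -> l <= 0 -> distortion (tilt Q l) = D ->
  rate_fixed P rho Q D = ((l * D - Lambda P rho Q l) / ln 2)%:E.
Proof.
move=> hQ l0 dD; apply/eqP; rewrite eq_le; apply/andP; split.
  apply: ge_ereal_inf; eexists; first exists (tilt Q l).
  - split; [exact: is_pmf_tilt|by move=> x; exact: marginal1_tilt|].
    by rewrite -/(distortion _) dD.
  - by [].
  have ht := is_pmf_tilt l hQ; have t1 x := marginal1_tilt l x hQ.
  have tQ := @marginal2_tilt_dominated Q l.
  rewrite info_divergenceE// lee_fin (kl_tilt l)//; last exact: prod_pmf_dominated.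
  by rewrite dD kl_self add0r.
apply: le_ereal_inf_tmp => _ [W [hW W1 WD] <-].
have [WQ|WQ] := eqVneq (rel_entropy (marginal2 W) Q) +oo%E.
  rewrite WQ /mutual_info rel_entropyE; last exact: mutual_info_dominated.
  by rewrite addey// leey.
have {}WQ := rel_entropy_dominated WQ.
have WPQ := prod_pmf_dominated hW WQ.
rewrite info_divergenceE// lee_fin ler_pM2r ?invr_gt0 ?ln2_gt0//.
rewrite (kl_tilt l)//.
have h1 : 0 <= kl W (tilt Q l).
  by apply: kl_ge0 => //; [exact: is_pmf_tilt|exact: tilt_dominated].
have h2 : l * D <= l * distortion W by rewrite ler_wnM2l.
lra.
Qed.

Lemma rate_distortion_le Q D : is_pmf Q ->
  (rate_distortion P rho D <= rate_fixed P rho Q D)%E.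
Proof.
move=> hQ; apply: le_ereal_inf_tmp => _ [W hW <-].
apply: ge_ereal_inf; exists (mutual_info W); first by exists W.
rewrite leeDl// rel_entropy_ge0//.
by case: hW => hW _ _; exact: pmf_marginal2.
Qed.

(** * Consequences of the optimality of Q *)

Section OptimalChoice.
Variables (D l : R) (Q : T -> R).
Hypothesis opt : optimal_choice P rho D Q l.

Lemma optimal_distortion : distortion (tilt Q l) = D.
Proof.
case: opt => hQ _ _ dL; have dt := is_derive_Lambda l hQ.
by rewrite -(@derive_val _ _ _ _ _ _ _ dt) (@derive_val _ _ _ _ _ _ _ dL).
Qed.

Lemma rate_distortionE :
  rate_distortion P rho D = ((l * D - Lambda P rho Q l) / ln 2)%:E.
Proof.
case: opt => hQ <- l0 _; apply: rate_fixedE => //; first exact: ltW.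
exact: optimal_distortion.
Qed.

Lemma f_dist_eq0 x :
  (f_dist P rho D Q l x = 0) <-> (ln (inner_mgf rho Q l x) = Lambda P rho Q l).
Proof.
rewrite /f_dist rate_distortionE/= /log2 expRK.
have l2 := @ln2_gt0 R.
have -> : 1 / ln 2 * (l * D - ln (inner_mgf rho Q l x)) -
    (l * D - Lambda P rho Q l) / ln 2 =
    (Lambda P rho Q l - ln (inner_mgf rho Q l x)) / ln 2.
  by field; exact: lt0r_neq0.
split=> [/eqP|->]; last by rewrite subrr mul0r.
by rewrite mulf_eq0 invr_eq0 (gt_eqF l2) orbF subr_eq0 => /eqP.
Qed.

(* Otherwise the tilted coupling would have mutual information smaller than
   [R(D)] by [H(marginal2 || Q) > 0]. *)
Lemma marginal2_tilt : marginal2 (tilt Q l) =1 Q.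
Proof.
case: (opt) => hQ rQ l0 _.
have ht := is_pmf_tilt l hQ; have t1 x := marginal1_tilt l x hQ.
have tQ := @marginal2_tilt_dominated Q l.
have tPQ := prod_pmf_dominated ht tQ.
apply: kl_le0_eq => //; first exact: pmf_marginal2.
have : (rate_distortion P rho D <= mutual_info (tilt Q l))%E.
  apply: ereal_inf_lbound; exists (tilt Q l) => //; split=> //.
  by rewrite -/(distortion _) optimal_distortion.
rewrite rate_distortionE /mutual_info rel_entropyE; last exact: mutual_info_dominated.
rewrite lee_fin ler_pM2r ?invr_gt0 ?ln2_gt0//.
(* For the tilted coupling, mutual information plus the divergence of the marginal equals
   [l * D - Lambda], which is already at most the mutual information. *)
have := kl_chain ht t1 hQ tQ.
rewrite (kl_tilt l ht t1 hQ tPQ) optimal_distortion kl_self; lra.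
Qed.

End OptimalChoice.
End TiltedCoupling.

(** * Uniform source and permutation distortion: part (a) *)

Section UniformSource.
Context {R : realType} {T : finType}.
Variables (P : T -> R) (rho : T -> T -> R).
Hypotheses (hP : is_pmf P) (P_gt0 : forall x, 0 < P x).
Hypotheses (rho_ge0 : forall x y, 0 <= rho x y)
  (rho_sym : forall x y, rho x y = rho y x)
  (rho_eq0 : forall x y, rho x y = 0 <-> x = y).
Implicit Types (Q : T -> R) (l D : R) (x y z : T).

Lemma D_max_le y : D_max P rho <= \sum_x P x * rho x y.
Proof.
apply: ge_inf; last by exists y.
exists 0 => _ [z _ <-]; apply: sumr_ge0 => x _.
by rewrite mulr_ge0// ltW.
Qed.

(* Equal tiltings with distinct parameters force [rho x] to be constant on the
   support of [Q]; as [rho] vanishes only on the diagonal, [Q] is a Dirac mass. *)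
Lemma tilt_inj Q l l' : is_pmf Q -> distortion rho (tilt P rho Q l) < D_max P rho ->
  tilt P rho Q l =1 tilt P rho Q l' -> l = l'.
Proof.
move=> hQ dlt tE; apply: contraPP dlt => /eqP ll'; apply/negP; rewrite -leNgt.
have [y Qy] : exists y, Q y != 0.
  apply: contrapT => /forallNP Q0; case: hQ => _; rewrite big1.
    by move/eqP; rewrite eq_sym oner_eq0.
  by move=> y _; apply/eqP/negPn/negP; exact: Q0.
have supp x z : Q z != 0 -> expR (l * rho x z) / inner_mgf rho Q l x =
    expR (l' * rho x z) / inner_mgf rho Q l' x.
  move=> Qz; have := tE (x, z); rewrite /tilt/= => /(mulfI (lt0r_neq0 (P_gt0 x))).
  by rewrite -!mulrA => /(mulfI Qz).
(* In row [y], the diagonal entry shows that the normalisers agree; the entry at [z] then gives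
   [(l - l') * rho y z = 0]. *)
have Qdirac z : z != y -> Q z = 0.
  move=> zy; apply: contra_neq_eq zy => Qz.
  have := supp y y Qy; rewrite (proj2 (rho_eq0 y y) erefl) !mulr0 !expR0 => MM.
  have := supp y z Qz; rewrite -[X in X = _]mul1r -[X in _ = X]mul1r.
  have M0 := lt0r_neq0 (inner_mgf_gt0 rho l y hQ).
  have M0' := lt0r_neq0 (inner_mgf_gt0 rho l' y hQ).
  rewrite !mul1r in MM *; rewrite MM.
  move=> /(mulIf (invr_neq0 M0')) /expR_inj /eqP.
  rewrite -subr_eq0 -mulrBl mulf_eq0 subr_eq0 (negPf ll')/= => /eqP.
  by move/rho_eq0.
have t0 x z : z != y -> tilt P rho Q l (x, z) = 0.
  by move=> /Qdirac Qz; rewrite /tilt/= Qz !mul0r mulr0.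
apply: le_trans (D_max_le y) _; rewrite /distortion sum_pair.
rewrite le_eqVlt; apply/orP; left; apply/eqP; apply: eq_bigr => x _.
rewrite (bigD1 y)//= [X in _ + X]big1 ?addr0; last first.
  by move=> z /(t0 x) ->; rewrite mul0r.
rewrite -{1}(marginal1_tilt P rho l x hQ) /marginal1 (bigD1 y)//=.
by rewrite [X in _ + X]big1 ?addr0// => z /(t0 x).
Qed.

Hypotheses (P_unif : is_uniform P) (rho_perm : permutation_distortion rho).

Lemma sum_row (F : R -> R) x x' :
  \sum_y P y * F (rho x y) = \sum_y P y * F (rho x' y).
Proof.
have [s rho_s] := rho_perm x x'.
rewrite [LHS](reindex_inj (@perm_inj _ s))/=.
by apply: eq_bigr => y _; rewrite rho_s !P_unif.
Qed.

Lemma uniform_mgf l x x' : inner_mgf rho P l x = inner_mgf rho P l x'.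
Proof. exact: (sum_row (fun r => expR (l * r))). Qed.

Lemma uniform_Lambda l x : Lambda P rho P l = ln (inner_mgf rho P l x).
Proof.
rewrite /Lambda; under eq_bigr => y _ do rewrite (uniform_mgf l y x).
by rewrite -mulr_suml (proj2 hP) mul1r.
Qed.

Lemma uniform_distortion l x : distortion rho (tilt P rho P l) =
  (\sum_y P y * (expR (l * rho x y) * rho x y)) / inner_mgf rho P l x.
Proof.
rewrite /distortion sum_pair -[RHS]mul1r -(proj2 hP) [RHS]mulr_suml.
apply: eq_bigr => x' _.
rewrite (uniform_mgf l x x') (sum_row (fun r => expR (l * r) * r) x x').
rewrite mulr_suml mulr_sumr; apply: eq_bigr => y _.
by rewrite /tilt/=; ring.
Qed.

(* The intermediate value theorem between [0], where the distortion is at least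
   [D_max], and [- #|T| / D]; there the diagonal contributes [- D / #|T|] and
   [t * expR (- t) <= 1] bounds the rest. *)
Lemma uniform_param D : 0 < D < D_max P rho -> (0 < #|T|)%N ->
  exists2 l, l <= 0 & distortion rho (tilt P rho P l) = D.
Proof.
move=> /andP[D0 Dmax] /card_gt0P[x _].
(* [g l] is the excess of the tilted distortion over [D], multiplied by the positive
   [inner_mgf rho P l x]; all rows being alike, row [x] suffices. *)
pose g l := \sum_y P y * (expR (l * rho x y) * (rho x y - D)).
pose L : R := #|T|%:R / D.
have T0 : 0 < #|T|%:R :> R by rewrite ltr0n; apply/card_gt0P; exists x.
have L0 : 0 < L by rewrite divr_gt0.
have gcont : continuous g.
  apply: continuous_big; first exact: add_continuous.
  move=> y _.
  have expr_cont : continuous (expR \o (fun t => t * rho x y)).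
    move=> t; apply: continuous_comp; last exact: continuous_expR.
    by apply: cvgM; [exact: cvg_id|exact: cvg_cst].
  move=> l; apply: cvgM; first exact: cvg_cst.
  by apply: cvgM; [exact: expr_cont|exact: cvg_cst].
have g0 : 0 <= g 0.
  rewrite /g; under eq_bigr do rewrite mul0r expR0 mul1r mulrBr.
  rewrite sumrB -mulr_suml (proj2 hP) mul1r subr_ge0.
  apply: le_trans (ltW Dmax) _.
  by under eq_bigr do rewrite rho_sym; exact: D_max_le.
have gL : g (- L) <= 0.
  rewrite /g (bigD1 x)//= (proj2 (rho_eq0 x x) erefl) mulr0 expR0 mul1r sub0r.
  have -> : P x * - D = - L^-1.
    by rewrite P_unif /L invf_div mulrN mulrC.
  rewrite addrC subr_le0 -[leRHS]mul1r -(proj2 hP) mulr_suml.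
  rewrite [leRHS](bigD1 x)//= -[leLHS]add0r; apply: lerD.
    by rewrite mulr_ge0 ?invr_ge0// ltW.
  apply: ler_sum => y _; rewrite ler_pM2l//.
  rewrite -(ler_pM2l L0) divff ?lt0r_neq0//.
  have e0 := expR_gt0 (L * rho x y).
  rewrite mulNr expRN mulrCA mulrC ler_pdivrMr// mul1r.
  apply: le_trans (_ : 1 + L * rho x y <= _); last exact: expR_ge1Dx.
  by rewrite mulrBr; have := mulr_gt0 L0 D0; lra.
have [l] := @IVT R g (- L) 0 0 (ltac:(by rewrite oppr_le0 ltW))
  (continuous_subspaceT gcont)
  (ltac:(by rewrite ge_min gL/= le_max g0 orbT)).
rewrite in_itv/= => /andP[_ l0] gl; exists l => //.
rewrite (uniform_distortion l x).
apply: (canLR (mulfK (lt0r_neq0 (inner_mgf_gt0 rho l x hP)))).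
apply: subr0_eq; rewrite -[RHS]gl /g /inner_mgf mulr_sumr -sumrB.
by apply: eq_bigr => y _; ring.
Qed.

(** After exchanging sums, symmetry of [rho] makes the inner sum the [inner_mgf] of row [y] under
    [P], the same for all rows, so [Q] averages out. *)
Lemma mean_inner_mgf Q l x : is_pmf Q ->
  \sum_x' P x' * inner_mgf rho Q l x' = inner_mgf rho P l x.
Proof.
move=> hQ; rewrite -[RHS]mul1r -(proj2 hQ) [RHS]mulr_suml.
under eq_bigr do rewrite mulr_sumr; rewrite exchange_big/=.
apply: eq_bigr => y _; rewrite (uniform_mgf l x y) mulr_sumr.
by apply: eq_bigr => x' _; rewrite rho_sym; ring.
Qed.

(* Writes the gap in Jensen's inequality for [ln] as a relative entropy, so that the
   equality case of Gibbs' inequality covers that of Jensen's. *)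
Lemma jensen_gap Q l x : is_pmf Q ->
  let q x' := P x' * inner_mgf rho Q l x' / inner_mgf rho P l x in
  is_pmf q /\ kl P q = ln (inner_mgf rho P l x) - Lambda P rho Q l.
Proof.
move=> hQ q; have c0 := inner_mgf_gt0 rho l x hP.
have M0 x' := inner_mgf_gt0 rho l x' hQ; split.
  split=> [x'|]; first by rewrite divr_ge0 ?mulr_ge0// ltW.
  by rewrite -mulr_suml (mean_inner_mgf l x hQ) divff// lt0r_neq0.
rewrite -[X in X - _]mul1r -(proj2 hP) mulr_suml -sumrB.
apply: eq_bigr => x' _; rewrite -mulrBr -ln_div ?posrE//; congr (_ * ln _).
by rewrite /q; field; rewrite !lt0r_neq0.
Qed.

(* [R(D) <= R(P,P,D) = lU D - Lambda_P(lU) <= lU D - Lambda_Q(lU) <= R(D)], by Jensen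
   and Gibbs; the equality cases make [inner_mgf Q lU] constant and give [l = lU]. *)
Lemma uniform_f_dist_eq0 D l Q : 0 < D < D_max P rho ->
  optimal_choice P rho D Q l -> forall x, f_dist P rho D Q l x = 0.
Proof.
move=> hD opt x; apply/(f_dist_eq0 hP P_gt0 opt).
have [hQ _ _ _] := opt.
have [lU lU0 dU] : exists2 lU, lU <= 0 & distortion rho (tilt P rho P lU) = D.
  by apply: uniform_param => //; apply/card_gt0P; exists x.
have dQ := optimal_distortion opt.
have ht := is_pmf_tilt rho hP P_gt0 l hQ.
have t1 x' := marginal1_tilt P rho l x' hQ.
have tQ : dominated (marginal2 (tilt P rho Q l)) Q.
  exact: marginal2_tilt_dominated.
have tPQ := prod_pmf_dominated P_gt0 ht tQ.
have ht' := is_pmf_tilt rho hP P_gt0 lU hQ.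
have tt' := tilt_dominated (rho := rho) (l := lU) hQ tPQ.
have [hq klq] := jensen_gap lU x hQ.
have c0 := inner_mgf_gt0 rho lU x hP.
have Pq : dominated P (fun x' => P x' * inner_mgf rho Q lU x' / inner_mgf rho P lU x).
  move=> x' /eqP; rewrite gt_eqF// divr_gt0// mulr_gt0//.
  exact: inner_mgf_gt0.
have kl1 := kl_ge0 hP hq Pq.
have kl2 := kl_ge0 ht ht' tt'.
have le_rate : l * D - Lambda P rho Q l <= lU * D - ln (inner_mgf rho P lU x).
  have := rate_distortion_le P rho D hP.
  rewrite (rate_distortionE hP P_gt0 opt) (rate_fixedE hP P_gt0 hP lU0 dU).
  by rewrite lee_fin ler_pM2r ?invr_gt0 ?ln2_gt0// (uniform_Lambda lU x).
(* Expanding the same divergence at [l] and at [lU] and inserting [le_rate] bounds the sum of the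
   two nonnegative divergences of [kl1] and [kl2] by 0. *)
have e1 := kl_tilt rho P_gt0 l ht t1 hQ tPQ.
have e2 := kl_tilt rho P_gt0 lU ht t1 hQ tPQ.
rewrite dQ kl_self in e1; rewrite dQ in e2.
have Pq_eq : P =1 (fun x' => P x' * inner_mgf rho Q lU x' / inner_mgf rho P lU x).
  by apply: kl_le0_eq => //; rewrite klq; rewrite klq in kl1; lra.
have tE : tilt P rho Q l =1 tilt P rho Q lU.
  by apply: kl_le0_eq => //; rewrite klq in kl1; lra.
have llU : l = lU by apply: (tilt_inj hQ) => //; rewrite dQ; case/andP: hD.
have Mc x' : inner_mgf rho Q l x' = inner_mgf rho P lU x.
  apply: (mulfI (lt0r_neq0 (P_gt0 x'))).
  by rewrite [in RHS]Pq_eq mulfVK ?lt0r_neq0// llU.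
rewrite /Lambda; under [RHS]eq_bigr do rewrite Mc.
by rewrite -mulr_suml (proj2 hP) mul1r Mc.
Qed.

End UniformSource.

(** * Exponential sums determine their exponents *)

Lemma expR_sum_lt (R : realType) (a b : R) (t : seq R) : a < b ->
  {in t, forall x, b <= x} ->
  exists B, forall l, l <= B -> \sum_(x <- t) expR (l * x) < expR (l * a).
Proof.
move=> ab tb; have ba : 0 < b - a by rewrite subr_gt0.
(* With [n = size t], this bound gives [l * (b - a) <= - n], and [n * expR (- n) < 1]. *)
exists (- ((size t)%:R / (b - a))) => l lB.
have l0 : l <= 0 by apply: le_trans lB _; rewrite oppr_le0 divr_ge0// ltW.
apply: (@le_lt_trans _ _ (\sum_(x <- t) expR (l * b))).
  rewrite !big_seq; apply: ler_sum => x xt.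
  by rewrite ler_expR ler_wnM2l// tb.
rewrite big_const_seq count_predT iter_addr_0 -mulr_natl.
have -> : l * b = l * a + l * (b - a) by ring.
rewrite expRD mulrCA -[ltRHS]mulr1 ltr_pM2l ?expR_gt0//.
have : l * (b - a) <= - (size t)%:R by rewrite -ler_pdivlMr// mulNr.
move=> le_n; apply: (@le_lt_trans _ _ ((size t)%:R * expR (- (size t)%:R))).
  by rewrite ler_wpM2l// ler_expR.
rewrite expRN ltr_pdivrMr ?expR_gt0// mul1r.
by apply: lt_le_trans (expR_ge1Dx _); rewrite ltrDr.
Qed.

(* As [l] tends to [-oo], each sum is dominated by its smallest exponent. *)
Lemma expR_sum_sorted_eq (R : realType) (s t : seq R) :
  sorted <=%R s -> sorted <=%R t ->
  (forall B, exists2 l, l <= B &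
    \sum_(x <- s) expR (l * x) = \sum_(x <- t) expR (l * x)) ->
  s = t.
Proof.
have sum_gt0 u (a l : R) : 0 < \sum_(x <- a :: u) expR (l * x).
  by rewrite big_cons ltr_pwDl ?expR_gt0//; apply: sumr_ge0 => x _; exact: expR_ge0.
(* If [a < b], the second sum eventually falls below [expR (l * a)], a single term of the first. *)
have head_lt (a b : R) u v : (forall B, exists2 l, l <= B &
    \sum_(x <- a :: u) expR (l * x) = \sum_(x <- b :: v) expR (l * x)) ->
    sorted <=%R (b :: v) -> b <= a.
  move=> uv sv; rewrite leNgt; apply/negP => ab.
  have bv : {in b :: v, forall x, b <= x}.
    move=> x; rewrite inE => /predU1P[->//|].
    by move/(allP (order_path_min le_trans sv)).
  have [B HB] := expR_sum_lt ab bv.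
  have [l lB] := uv B; have := HB l lB => /[swap] <-.
  rewrite big_cons ltNge lerDl; case/negP.
  by apply: sumr_ge0 => x _; exact: expR_ge0.
elim: s t => [|a s IHs] [|b t] ss st sum_eq //.
- have [l _] := sum_eq 0; rewrite big_nil => /eqP.
  by rewrite eq_sym gt_eqF.
- by have [l _] := sum_eq 0; rewrite big_nil => /eqP; rewrite gt_eqF.
have ab : a = b.
  apply/eqP; rewrite eq_le (head_lt _ _ _ _ sum_eq st) andbT.
  apply: (head_lt _ _ t s) ss => B; have [l lB e] := sum_eq B.
  by exists l.
rewrite ab; congr cons; apply: IHs.
- exact: path_sorted ss.
- exact: path_sorted st.
move=> B; have [l lB e] := sum_eq B; exists l => //.
by move: e; rewrite !big_cons ab => /addrI.
Qed.

Lemma expR_sum_perm_eq (R : realType) (s t : seq R) :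
  (forall B, exists2 l, l <= B &
    \sum_(x <- s) expR (l * x) = \sum_(x <- t) expR (l * x)) ->
  perm_eq s t.
Proof.
move=> sum_eq; apply/(perm_sortP le_total le_trans le_anti).
apply: expR_sum_sorted_eq; [exact: sort_le_sorted|exact: sort_le_sorted|].
move=> B; have [l lB e] := sum_eq B; exists l => //.
by rewrite !(perm_big _ (permEl (perm_sort _ _))).
Qed.

(** [tuple_permP] permutes positions in the enumeration of [T]; conjugation by [enum_rank] makes
    this a permutation of [T]. *)
Lemma perm_eq_codom (T : finType) (V : eqType) (f g : T -> V) :
  perm_eq (codom g) (codom f) -> exists s : {perm T}, forall x, g x = f (s x).
Proof.
move=> /(@tuple_permP _ _ _ (codom_tuple f))[p gp].
pose h x := enum_val (p (enum_rank x)).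
have h_inj : injective h by move=> x y /enum_val_inj/perm_inj/enum_rank_inj.
exists (perm h_inj) => x; rewrite permE /h.
have := congr1 (fun u => nth (g x) u (enum_rank x)) gp.
rewrite (nth_map x) -?cardE ?ltn_ord// nth_enum_rank => ->.
rewrite -tnth_nth tnth_mktuple (tnth_nth (g x)) (nth_map x) -?cardE ?ltn_ord//.
by rewrite -enum_val_nth.
Qed.

Lemma finite_pos_lbound (R : realType) (I : finType) (F : I -> R) :
  (forall i, 0 < F i) -> exists2 m, 0 < m & forall i, m <= F i.
Proof.
(* The base value 1 keeps the minimum positive when [I] is empty. *)
move=> F0; exists (\big[Num.min/1]_i F i) => [|i].
  by apply: lt_bigmin => // i _; exact: F0.
exact: bigmin_le.
Qed.

(** * The limit of small distortion: part (b) *)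

Section SmallDistortion.
Context {R : realType} {T : finType}.
Variables (P : T -> R) (rho : T -> T -> R).
Hypotheses (hP : is_pmf P) (P_gt0 : forall x, 0 < P x).
Hypotheses (rho_ge0 : forall x y, 0 <= rho x y)
  (rho_sym : forall x y, rho x y = rho y x)
  (rho_eq0 : forall x y, rho x y = 0 <-> x = y).
Hypothesis D_max_gt0 : 0 < D_max P rho.
Implicit Types (Q : T -> R) (l D : R) (x y z : T).

(* The tilted coupling is close to the diagonal when [D] is small, which forces [Q]
   to have full support; dividing [marginal2 = Q] by [Q y] gives the column sums. *)
Lemma small_distortion (e : R) : 0 < e -> exists2 delta : R, 0 < delta &
  forall D l Q, D < delta -> optimal_choice P rho D Q l ->
    (forall x, f_dist P rho D Q l x = 0) ->
  [/\ l <= 0, forall x y, x != y -> expR (l * rho x y) <= e &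
      exists c, forall y, \sum_x P x * expR (l * rho x y) = c].
Proof.
move=> e0.
have [m m0 mP] := finite_pos_lbound P_gt0.
have [r r0 rrho] : exists2 r, 0 < r & forall x y, x != y -> r <= rho x y.
  have [|r r0 H] := @finite_pos_lbound R (T * T)%type
      (fun xy => if xy.1 == xy.2 then 1 else rho xy.1 xy.2).
    move=> [x y]/=; case: eqVneq => // xy.
    by rewrite lt_def rho_ge0 andbT; apply: contra_neq xy => /rho_eq0.
  by exists r => // x y xy; have := H (x, y); rewrite /= (negPf xy).
have mr0 := mulr_gt0 m0 r0.
have emr0 := mulr_gt0 (mulr_gt0 e0 m0) mr0.
(* The first bound leaves off-diagonal mass at most [m / 2] in each row, hence [Q >= m / 2]; the
   second then bounds the off-diagonal exponentials by [e]. *)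
exists (Num.min (m * r / 2) (e * m * (m * r) / 2)).
  by rewrite lt_min !divr_gt0.
move=> D l Q; rewrite lt_min => /andP[D1 D2] opt f0.
have [hQ _ l0 _] := opt.
have dQ := optimal_distortion opt.
have mQ := marginal2_tilt hP P_gt0 opt.
have V0 := fun xz => tilt_ge0 rho P_gt0 l xz hQ.
have VD x z : tilt P rho Q l (x, z) * rho x z <= D.
  rewrite -dQ /distortion (bigD1 (x, z))//= lerDl.
  by apply: sumr_ge0 => xz _; rewrite mulr_ge0.
(* Row [z] has mass at least [m], so its diagonal entry is at least [m / 2]; column [z], of mass
   [Q z], contains that entry. *)
have Q_ge z : m / 2 <= Q z.
  have off_diag : (\sum_(y | y != z) tilt P rho Q l (z, y)) * r <= D.
    rewrite -dQ /distortion sum_pair [leRHS](bigD1 z)//= [X in _ <= X + _](bigD1 z)//=.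
    rewrite (proj2 (rho_eq0 z z) erefl) mulr0 add0r mulr_suml.
    rewrite -[leLHS]addr0; apply: lerD; last first.
      by do 2![apply: sumr_ge0 => ? _]; rewrite mulr_ge0.
    apply: ler_sum => y yz; rewrite ler_wpM2l//.
    by apply: rrho; rewrite eq_sym.
  have diag : tilt P rho Q l (z, z) <= Q z.
    by rewrite -[leRHS]mQ /marginal2 (bigD1 z)//= lerDl sumr_ge0.
  have := marginal1_tilt P rho l z hQ; rewrite /marginal1 (bigD1 z)//= => row.
  have off_le : \sum_(y | y != z) tilt P rho Q l (z, y) <= m / 2.
    rewrite -(ler_pM2r r0); apply: le_trans off_diag _.
    by rewrite mulrAC; exact: ltW.
  have := mP z; lra.
have Q0 z : 0 < Q z by apply: lt_le_trans (Q_ge z); rewrite divr_gt0.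
have M0 x := inner_mgf_gt0 rho l x hQ.
have M1 x : inner_mgf rho Q l x <= 1.
  rewrite -(proj2 hQ); apply: ler_sum => y _.
  rewrite -[leRHS]mulr1 ler_pM2l// -expR0 ler_expR.
  by rewrite mulr_le0_ge0// ltW.
split; first exact: ltW.
- move=> x y xy; have rxy := rrho x y xy.
  have E0 := expR_gt0 (l * rho x y).
  have V_ge : m * (m / 2) * expR (l * rho x y) <= tilt P rho Q l (x, y).
    rewrite /tilt/= -mulrA; apply: ler_pM => //; first exact: ltW.
      by rewrite ltW// mulr_gt0// divr_gt0.
    apply: (@le_trans _ _ (Q y * expR (l * rho x y))); first by rewrite ler_pM2r.
    by rewrite ler_pdivlMr// ler_piMr// ltW// mulr_gt0.
  have lower : m * (m / 2) * expR (l * rho x y) * r <= D.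
    apply: le_trans (VD x y); apply: ler_pM => //; last exact: ltW.
    by rewrite ltW// !mulr_gt0// invr_gt0.
  have mmr0 := mulr_gt0 m0 mr0.
  rewrite -(ler_pM2r mmr0).
  by move: lower D2; lra.
- exists (expR (Lambda P rho Q l)) => y.
  have Mc x : inner_mgf rho Q l x = expR (Lambda P rho Q l).
    by rewrite -(proj1 (f_dist_eq0 hP P_gt0 opt x) (f0 x)) lnK// posrE.
  rewrite -[RHS]mul1r -(divff (lt0r_neq0 (Q0 y))) -{1}mQ /marginal2 !mulr_suml.
  apply: eq_bigr => x _; rewrite /tilt/= Mc; field.
  by rewrite !lt0r_neq0// expR_gt0.
Qed.

Hypothesis small : forall e : R, 0 < e -> exists l,
  [/\ l <= 0, forall x y, x != y -> expR (l * rho x y) <= e &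
      exists c, forall y, \sum_x P x * expR (l * rho x y) = c].

(** Column [y] has diagonal term [P y] and off-diagonal part between 0 and [e], so
    [P y <= c <= P y + e] for every [y]. *)
Lemma small_distortion_uniform : is_uniform P.
Proof.
have P_le y y' : P y <= P y'.
  apply/ler_addgt0Pr => e e0; have [l [_ le_e [c sum_c]]] := small e0.
  have c_ge : P y <= c.
    rewrite -(sum_c y) (bigD1 y)//= (proj2 (rho_eq0 y y) erefl) mulr0 expR0 mulr1.
    by rewrite lerDl sumr_ge0// => x _; rewrite mulr_ge0 ?expR_ge0// ltW.
  apply: le_trans c_ge _.
  rewrite -(sum_c y') (bigD1 y')//= (proj2 (rho_eq0 y' y') erefl) mulr0 expR0 mulr1.
  rewrite lerD2l; apply: (@le_trans _ _ (\sum_(x | x != y') P x * e)).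
    by apply: ler_sum => x xy; rewrite ler_pM2l// le_e.
  rewrite -mulr_suml; apply: ler_piMl; first exact: ltW.
  by rewrite -(proj2 hP) [leRHS](bigD1 y')//= lerDr ltW.
move=> y; have cst_P x : P x = P y by apply/eqP; rewrite eq_le !P_le.
have Py1 : #|T|%:R * P y = 1.
  by rewrite -[RHS](proj2 hP) (eq_bigr (fun=> P y))// sumr_const mulr_natl.
have T0 : #|T|%:R != 0 :> R.
  by apply/eqP => T0; move: Py1; rewrite T0 mul0r => /eqP; rewrite eq_sym oner_eq0.
by apply: (mulfI T0); rewrite Py1 divff.
Qed.

Lemma small_distortion_permutation : permutation_distortion rho.
Proof.
move=> i i'.
(* On a single point [D_max] would be 0. A second point is needed to turn small exponentials into
   very negative [l]. *)
have [x ix] : exists x, x != i.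
  apply: contrapT => /forallNP Ti; move: D_max_gt0; apply/negP; rewrite -leNgt.
  apply: le_trans (D_max_le P_gt0 rho_ge0 i) _.
  rewrite big1// => y _; have /negP := Ti y; rewrite negbK => /eqP ->.
  by rewrite (proj2 (rho_eq0 i i) erefl) mulr0.
have rxi : 0 < rho x i.
  by rewrite lt_def rho_ge0 andbT; apply: contra_neq ix => /rho_eq0.
apply: perm_eq_codom; apply: expR_sum_perm_eq => B.
(* With this threshold, [expR (l * rho x i) <= expR (B * rho x i)] forces [l <= B]. *)
have [l [_ le_e [c sum_c]]] := small (expR_gt0 (B * rho x i)).
exists l; first by have := le_e _ _ ix; rewrite ler_expR ler_pM2r.
have row k : \sum_(y <- codom (rho k)) expR (l * y) = #|T|%:R * c.
  rewrite -(sum_c k) big_image/= mulr_sumr; apply: eq_bigr => y _.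
  rewrite small_distortion_uniform mulrA divff ?mul1r 1?rho_sym//.
  by rewrite pnatr_eq0 -lt0n; apply/card_gt0P; exists y.
by rewrite !row.
Qed.

End SmallDistortion.

(** * From almost sure to pointwise vanishing, and the conclusion *)

Lemma has_law_almost_sure (R : realType) (T : finType) (d : measure_display)
    (Omega : measurableType d) (Pr : probability Omega R)
    (X : Omega -> T) (P : T -> R) (E : T -> Prop) :
  (forall a, 0 < P a) -> has_law Pr X P ->
  Pr [set w | E (X w)] = 1%E <-> forall a, E a.
Proof.
move=> P_gt0 hX; split=> [PE a|allE]; last first.
  rewrite (_ : [set _ | _] = setT) ?probability_setT//.
  by apply/seteqP; split=> // w _; exact: allE.
apply: contrapT => nEa; have [mXa PXa] := hX a.
have mE : measurable [set w | E (X w)].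
  rewrite (_ : [set _ | _] = \bigcup_(b in [set b | E b]) X @^-1` [set b]).
    by apply: fin_bigcup_measurable => // b _; case: (hX b).
  by apply/seteqP; split=> w /=; [exists (X w)|case=> b Eb ->].
(* The event misses the fibre over [a], which has mass [P a > 0]. *)
have : (Pr [set w | E (X w)] <= Pr (~` (X @^-1` [set a])))%E.
  apply: le_measure; rewrite ?inE//; first exact: measurableC.
  by move=> w /= Ew Xw; apply: nEa; rewrite -Xw.
rewrite PE probability_setC// PXa -EFinB lee_fin.
by have := P_gt0 a; lra.
Qed.

Theorem theorem1 (R : realType) (A : {fset R}) (P : A -> R) (rho : A -> A -> R)
    (hP : is_pmf P) (hPpos : forall i, 0 < P i)
    (hrho0 : forall i j, 0 <= rho i j)
    (hrhosym : forall i j, rho i j = rho j i)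
    (hrhoid : forall i j, rho i j = 0 <-> i = j)
    (hDmax : 0 < D_max P rho)
    (d : measure_display) (Omega : measurableType d)
    (Pr : probability Omega R) (X1 : Omega -> A) (hX1 : has_law Pr X1 P)
    (Qstar : R -> A -> R) (lstar : R -> R)
    (hstar : forall D : R, 0 < D < D_max P rho ->
       optimal_choice P rho D (Qstar D) (lstar D)) :
  let f := fun D => f_dist P rho D (Qstar D) (lstar D) in
  let f_vanishes := fun D => Pr [set w | f D (X1 w) = 0] = 1%E in
  (is_uniform P -> permutation_distortion rho ->
     forall D : R, 0 < D < D_max P rho -> f_vanishes D)
  /\
  (forall Dn : nat -> R,
     (forall n, 0 < Dn n < D_max P rho) ->
     nonincreasing_seq Dn -> Dn @ \oo --> 0 ->
     (forall n, f_vanishes (Dn n)) ->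
     [/\ is_uniform P, permutation_distortion rho &
         forall D : R, 0 < D < D_max P rho -> f_vanishes D]).
Proof.
move=> f f_vanishes.
have vanishesP D : f_vanishes D <-> forall x, f D x = 0.
  exact: (has_law_almost_sure (fun x => f D x = 0) hPpos hX1).
have vanish : is_uniform P -> permutation_distortion rho ->
    forall D : R, 0 < D < D_max P rho -> f_vanishes D.
  move=> Pu rp D hD; apply/vanishesP => x.
  by apply: uniform_f_dist_eq0 => //; exact: hstar.
split=> // Dn hDn _ Dn0 Dn_vanishes.
have small e : 0 < e -> exists l,
    [/\ l <= 0, forall x y, x != y -> expR (l * rho x y) <= e &
        exists c, forall y, \sum_x P x * expR (l * rho x y) = c].
  move=> e0.
  have [delta delta0 H] := small_distortion hP hPpos hrho0 hrhoid e0.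
  have [n Dn_lt] : exists n, Dn n < delta.
    have /cvgrPdist_lt/(_ delta delta0)[n _ /(_ n (leqnn n))] := Dn0.
    by rewrite /= sub0r normrN => /(le_lt_trans (ler_norm _)) Dn_lt; exists n.
  exists (lstar (Dn n)); apply: H Dn_lt (hstar _ (hDn n)) _.
  exact/vanishesP.
have Pu := small_distortion_uniform hP hPpos hrhoid small.
have rp := small_distortion_permutation hP hPpos hrho0 hrhosym hrhoid hDmax small.
by split=> //; exact: vanish.
Qed.
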